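(* Let $n\ge 2$, let players $1,\dots,n$ have positive values $v_1,\dots,v_n$, and for each $i$ let $$p_i = \frac{1}{n-1}\sum_{j\ne i}\frac{v_i}{v_i+v_j}.$$ If the tournament format is $(r,m_1,\dots,m_r)$, then for every $i\in\{1,\dots,n\}$ $$P_i \leq \prod_{s=1}^r \left(\frac{2m_s}{r_s}\,p_i + 1 - \frac{2m_s}{r_s}\right),$$ where $r_s = n-\sum_{j=1}^{s-1} m_j$ is the number of players that advance to round $s$.
   Context: Random knockout tournament: there are $n\ge 2$ players $1,\dots,n$ with positive values $v_1,\dots,v_n$. A format is a tuple $(r,m_1,\dots,m_r)$ of positive integers with $\sum_{s=1}^r m_s = n-1$ and $2m_s \le r_s$ for each $s$, where $r_s = n-\sum_{j=1}^{s-1} m_j$ is the number of players still alive (not eliminated) at the start of round $s$. In round $s$, independently of the past given the set of alive players, $2m_s$ of the $r_s$ alive players are chosen uniformly at random and are uniformly randomly arranged into $m_s$ match pairs. A match between $i$ and $j$ is won by $i$ with probability $v_i/(v_i+v_j)$, independently of everything else. Losers are eliminated; the winners and the alive players not chosen to play advance to the next round. After round $r$ exactly one player remains, the winner of the tournament. $P_i$ denotes the probability that player $i$ wins the tournament. *)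

(* Defs.v *)
From mathcomp Require Import all_boot all_order all_algebra.
From mathcomp Require Import reals.

Set Implicit Arguments.
Unset Strict Implicit.
Unset Printing Implicit Defensive.

Import Order.TTheory GRing.Theory Num.Theory.
Local Open Scope ring_scope.

(* Rounds are numbered from 0. The format is the sequence of the numbers of
   matches, so the number of rounds is its size. *)
Definition players_left (n : nat) (ms : seq nat) (s : nat) : nat :=
  (n - sumn (take s ms))%N.

Definition is_format (n : nat) (ms : seq nat) : Prop :=
  [/\ (0 < size ms)%N,
      forall s : nat, (s < size ms)%N -> (0 < nth 0%N ms s)%N,
      sumn ms = (n - 1)%N &
      forall s : nat, (s < size ms)%N ->
        (2 * nth 0%N ms s <= players_left n ms s)%N].

Definition beat_prob (R : realType) (n : nat) (v : 'I_n -> R) (i j : 'I_n) : R :=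
  v i / (v i + v j).

Definition mean_beat_prob (R : realType) (n : nat) (v : 'I_n -> R) (i : 'I_n) : R :=
  (n - 1)%:R^-1 * \sum_(j < n | j != i) beat_prob v i j.

(* All ways to fill the 2m slots of a round with distinct alive players: match
   k opposes a (k, true) and a (k, false). Each choice of 2m players together
   with a pairing of them arises from the same number, m! * 2^m, of elements, so
   the uniform law on draws gives a uniform set of 2m players, uniformly paired. *)
Definition draws (n m : nat) (A : {set 'I_n}) : {set {ffun 'I_m * bool -> 'I_n}} :=
  [set a : {ffun 'I_m * bool -> 'I_n} | injectiveb a & [forall x, a x \in A]].

(* An outcome w of the round says that a (k, w k) wins match k. *)
Definition survivors (n m : nat) (A : {set 'I_n})
    (a : {ffun 'I_m * bool -> 'I_n}) (w : {ffun 'I_m -> bool}) : {set 'I_n} :=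
  A :\: [set a (k, ~~ w k) | k : 'I_m].

Definition outcome_prob (R : realType) (n m : nat) (v : 'I_n -> R)
    (a : {ffun 'I_m * bool -> 'I_n}) (w : {ffun 'I_m -> bool}) : R :=
  \prod_(k < m) beat_prob v (a (k, w k)) (a (k, ~~ w k)).

(* Conditional probability that B is the set of alive players after a round of
   m matches that started with the set A. *)
Definition round_kernel (R : realType) (n : nat) (v : 'I_n -> R) (m : nat)
    (A B : {set 'I_n}) : R :=
  \sum_(a in draws m A) #|draws m A|%:R^-1 *
    \sum_(w : {ffun 'I_m -> bool} | survivors A a w == B) outcome_prob v a w.

(* The sets of alive players form a Markov chain started at the set of all
   players; alive_law v ms is its law after the rounds ms. *)
Definition alive_law (R : realType) (n : nat) (v : 'I_n -> R) (ms : seq nat) :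
    {set 'I_n} -> R :=
  foldl (fun (mu : {set 'I_n} -> R) (m : nat) (B : {set 'I_n}) =>
           \sum_(A : {set 'I_n}) mu A * round_kernel v m A B)
        (fun B : {set 'I_n} => (B == [set: 'I_n])%:R) ms.

Definition win_prob (R : realType) (n : nat) (v : 'I_n -> R) (ms : seq nat)
    (i : 'I_n) : R :=
  alive_law v ms [set i].

(* Main.v *)
Require Import Defs.
From mathcomp Require Import all_boot all_order all_algebra.
From mathcomp Require Import fingroup perm.
From mathcomp Require Import reals zify ring lra.

(** Survival through all rounds is a product of conditional survival
    probabilities, so it is enough to bound each of them by the matching factor
    of the right-hand side.  If the set [A] of [r] alive players contains [i],
    then [i] plays in a round of [m] matches with probability [2m/r], against an
    opponent uniform in [A :\ i]; hence [i] survives the round with probability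
    [c Q(A) + 1 - c], where [c = 2m/r] and [Q(A)] is the mean of
    [beat_prob v i j] over [j] in [A :\ i] ([round_survive_prob]).  It remains
    to see that the conditional mean of [Q(A)], given that [i] is still alive,
    is at most [p_i = mean_beat_prob v i]: the players who
    are still there are tougher than average.

    Strong players are indeed more likely to be there.  Write [(j k)] for the
    transposition of two players with [v k <= v j].  Then every set [B] with
    [j \in B] and [k \notin B] is at least as likely to be the alive set as its
    image under [(j k)] ([alive_law_swap]).  This passes from one round to the
    next because the kernel has the same property: in a round after which [j]
    is alive and [k] is not, exchanging the roles of [j] and [k] can only
    replace winners by weaker players and losers by stronger ones
    ([round_kernel_swap]).
    Summing over sets, the probability that [i] and [j] are both alive is
    nondecreasing in [v j] ([both_alive_le]).  As [beat_prob v i j] is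
    nonincreasing in [v j], Chebyshev's sum inequality bounds the mean of
    [Q(A)] over the event that [i] is alive by [p_i] times the probability of
    that event ([alive_weighted_le]). *)

Set Implicit Arguments.
Unset Strict Implicit.
Unset Printing Implicit Defensive.

Import Order.TTheory GRing.Theory Num.Theory.
Local Open Scope ring_scope.

(** * Draws, survivors and relabelling of players *)

Lemma tperm_imset (T : finType) (A : {set T}) j k :
  j \in A -> k \in A -> tperm j k @: A = A.
Proof.
move=> jA kA; apply/setP => x.
rewrite -[x in LHS](tpermK j k) mem_imset; last exact: perm_inj.
by case: tpermP => [->|->|]; rewrite ?jA ?kA.
Qed.

Lemma drawsP {n m : nat} {A : {set 'I_n}} {a : {ffun 'I_m * bool -> 'I_n}} :
  reflect (injective a /\ forall x, a x \in A) (a \in draws m A).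
Proof.
rewrite inE; apply: (iffP andP) => -[injA inA]; split.
- exact/injectiveP.
- exact/forallP.
- exact/injectiveP.
- exact/forallP.
Qed.

Lemma card_draws n m (A : {set 'I_n}) : #|draws m A| = (#|A| ^_ (2 * m))%N.
Proof.
have -> : draws m A
    = [set a in ffun_on A
         | injectiveb (aT := ('I_m * bool)%type) (rT := 'I_n) a].
  apply/setP => a; rewrite [RHS]inE.
  apply/drawsP/andP => [[inj_a aA]|[/ffun_onP aA /injectiveP inj_a]] //.
  by split; [apply/ffun_onP | apply/injectiveP].
by rewrite card_inj_ffuns_on card_prod card_ord card_bool mulnC.
Qed.

Lemma in_survivors n m (A : {set 'I_n}) (a : {ffun 'I_m * bool -> 'I_n}) w i :
  (i \in survivors A a w) = (i \in A) && [forall k, a (k, ~~ w k) != i].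
Proof.
rewrite inE andbC; congr (_ && _).
apply/idP/forallP => [noloss k|noloss].
  by apply: contra noloss => /eqP <-; apply/imsetP; exists k.
by apply/imsetP => -[k _ def_i]; move: (noloss k); rewrite def_i eqxx.
Qed.

Definition relabel {n m : nat} (s : {perm 'I_n})
    (a : {ffun 'I_m * bool -> 'I_n}) : {ffun 'I_m * bool -> 'I_n} :=
  [ffun x => s (a x)].

Lemma relabel_inj n m s : injective (@relabel n m s).
Proof.
move=> a b /ffunP eq_sab; apply/ffunP => x.
by move: (eq_sab x); rewrite !ffunE => /perm_inj.
Qed.

Lemma relabel_draws n m (s : {perm 'I_n}) (A : {set 'I_n}) a :
  (relabel s a \in draws m (s @: A)) = (a \in draws m A).
Proof.
apply/drawsP/drawsP => -[inj_a aA]; split=> x.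
- by move=> y eq_a; apply: inj_a; rewrite !ffunE eq_a.
- by move: (aA x); rewrite ffunE mem_imset //; apply: perm_inj.
- by move=> y; rewrite !ffunE => /perm_inj/inj_a.
- by rewrite ffunE mem_imset //; apply: perm_inj.
Qed.

Lemma survivors_relabel n m (s : {perm 'I_n}) (A : {set 'I_n})
    (a : {ffun 'I_m * bool -> 'I_n}) w :
  survivors (s @: A) (relabel s a) w = s @: survivors A a w.
Proof.
apply/setP => i; rewrite -(permKV s i); set j := (s^-1)%g i.
rewrite mem_imset ?in_survivors; last exact: perm_inj.
rewrite mem_imset; last exact: perm_inj.
by congr (_ && _); apply: eq_forallb => k; rewrite ffunE (inj_eq perm_inj).
Qed.

(** * Exchanging a strong player with a weak one *)

Lemma beat_prob_ge0 (R : realType) n (v : 'I_n -> R) i j :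
  (forall l, 0 < v l) -> 0 <= beat_prob v i j.
Proof. by move=> v0; rewrite divr_ge0 ?addr_ge0 ?ltW. Qed.

Lemma outcome_prob_ge0 (R : realType) n m (v : 'I_n -> R)
    (a : {ffun 'I_m * bool -> 'I_n}) w :
  (forall l, 0 < v l) -> 0 <= outcome_prob v a w.
Proof. by move=> v0; apply: prodr_ge0 => k _; apply: beat_prob_ge0. Qed.

Lemma ler_beat_prob (R : realType) n (v : 'I_n -> R) i i' j j' :
    (forall l, 0 < v l) -> v i <= v i' -> v j' <= v j ->
  beat_prob v i j <= beat_prob v i' j'.
Proof.
move=> v0 le_i le_j; rewrite /beat_prob ler_pdivrMr ?addr_gt0 // mulrAC.
rewrite ler_pdivlMr ?addr_gt0 // !mulrDr [v i' * v i]mulrC lerD2l.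
by rewrite ler_pM // ltW.
Qed.

(** In every match the winner is not [k] and the loser is not [j], so the
    relabelling can only weaken winners and strengthen losers.  It may change
    two matches at once, or a match of [j] against [k] itself. *)
Lemma outcome_prob_swap (R : realType) n m (v : 'I_n -> R) (A : {set 'I_n})
    (a : {ffun 'I_m * bool -> 'I_n}) w j k :
    (forall l, 0 < v l) -> v k <= v j -> a \in draws m A ->
    j \in survivors A a w -> k \notin survivors A a w ->
  outcome_prob v (relabel (tperm j k) a) w <= outcome_prob v a w.
Proof.
move=> v0 le_kj /drawsP[inj_a aA].
rewrite !in_survivors => /andP[jA /forallP j_noloss] k_loss.
rewrite /outcome_prob; apply: ler_prod => q _; rewrite beat_prob_ge0 //= !ffunE.
apply: ler_beat_prob => //.
- (* The winner cannot be [k]: every player who wins a match survives. *)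
  case: tpermP => // [->|def_k] //.
  case/negP: k_loss; rewrite -def_k aA; apply/forallP => q'.
  by apply/eqP => /inj_a[-> ]; case: (w q).
- (* The loser cannot be [j], who survives. *)
  case: tpermP => // [def_j|-> //].
  by move: (j_noloss q); rewrite def_j eqxx.
Qed.

Lemma round_kernel_ge0 (R : realType) n (v : 'I_n -> R) m (A B : {set 'I_n}) :
  (forall l, 0 < v l) -> 0 <= round_kernel v m A B.
Proof.
move=> v0; apply: sumr_ge0 => a _; rewrite mulr_ge0 ?invr_ge0 //.
by apply: sumr_ge0 => w _; apply: outcome_prob_ge0.
Qed.

Lemma round_kernel_supp (R : realType) n (v : 'I_n -> R) m (A B : {set 'I_n}) :
  round_kernel v m A B != 0 -> B \subset A /\ (#|B| + m)%N = #|A|.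
Proof.
move=> K_neq0.
have [a aD /existsP[w /eqP <-]] : exists2 a, a \in draws m A
    & [exists w, survivors A a w == B].
  apply/exists_inP; apply: contraR K_neq0 => noaw; apply/eqP.
  rewrite /round_kernel big1 // => a aD; rewrite big_pred0 ?mulr0 // => w.
  apply: contraNF noaw => awB; apply/exists_inP; exists a => //.
  by apply/existsP; exists w.
have [inj_a aA] := drawsP aD; split; first exact: subsetDl.
rewrite cardsD (setIidPr _); last by apply/subsetP => _ /imsetP[k _ ->].
rewrite card_imset ?card_ord; last by move=> k l /inj_a[].
rewrite subnK // -[X in (X <= _)%N]card_ord.
rewrite -(card_imset (f := fun k : 'I_m => a (k, ~~ w k))); last first.
  by move=> k l /inj_a[].
by apply/subset_leq_card/subsetP => _ /imsetP[k _ ->].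
Qed.

(** Relabelling is a bijection from the draws on [A] to those on its image, and
    the outcomes that lead from [A] to [B] are those that lead from the image of
    [A] to the image of [B]; they can be compared one by one. *)
Lemma round_kernel_swap (R : realType) n (v : 'I_n -> R) m (A B : {set 'I_n})
    j k :
    (forall l, 0 < v l) -> v k <= v j -> j \in B -> k \notin B ->
  round_kernel v m (tperm j k @: A) (tperm j k @: B) <= round_kernel v m A B.
Proof.
move=> v0 le_kj jB kB; rewrite /round_kernel !card_draws.
rewrite card_imset; last exact: perm_inj.
rewrite (reindex_inj (@relabel_inj n m (tperm j k))) /=.
under eq_bigl => a do rewrite relabel_draws.
apply: ler_sum => a aD; rewrite ler_wpM2l ?invr_ge0 //.
have swap_surv w : (survivors (tperm j k @: A) (relabel (tperm j k) a) w
    == tperm j k @: B) = (survivors A a w == B).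
  by rewrite survivors_relabel (inj_eq (imset_inj perm_inj)).
rewrite (eq_bigl _ _ swap_surv); apply: ler_sum => w /eqP def_B.
by apply: (@outcome_prob_swap _ _ _ _ A); rewrite ?def_B.
Qed.

(** * The law of the set of alive players *)

Lemma alive_law_rcons (R : realType) n (v : 'I_n -> R) ms m B :
  alive_law v (rcons ms m) B
    = \sum_(A : {set 'I_n}) alive_law v ms A * round_kernel v m A B.
Proof. by rewrite /alive_law foldl_rcons. Qed.

Lemma alive_law_ge0 (R : realType) n (v : 'I_n -> R) ms B :
  (forall l, 0 < v l) -> 0 <= alive_law v ms B.
Proof.
move=> v0; elim/last_ind: ms B => [|ms m IH] B; first exact: ler0n.
rewrite alive_law_rcons; apply: sumr_ge0 => A _.
by rewrite mulr_ge0 ?round_kernel_ge0.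
Qed.

Lemma alive_law_supp (R : realType) n (v : 'I_n -> R) ms B :
  alive_law v ms B != 0 -> (#|B| + sumn ms)%N = n.
Proof.
elim/last_ind: ms B => [|ms m IH] B.
  rewrite /alive_law /=; case: (B =P setT) => [-> _|_]; last by rewrite eqxx.
  by rewrite cardsT card_ord addn0.
rewrite alive_law_rcons => B_neq0.
have [A] : exists A, alive_law v ms A * round_kernel v m A B != 0.
  apply/existsP; apply: contraR B_neq0 => noA; rewrite big1 // => A _.
  by apply/eqP; apply: contraNT noA => A_neq0; apply/existsP; exists A.
rewrite mulf_eq0 negb_or => /andP[/IH card_A /round_kernel_supp[_ card_B]].
by rewrite -[RHS]card_A -card_B sumn_rcons addnAC addnA.
Qed.

(** In the sum over the previous alive set [A], only sets containing [j] count.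
    If [k] is not in [A], the induction hypothesis applies to [A]; if [k] is in
    [A], the transposition fixes [A] and the inequality comes from the kernel
    alone. *)
Lemma alive_law_swap (R : realType) n (v : 'I_n -> R) ms (B : {set 'I_n}) j k :
    (forall l, 0 < v l) -> v k <= v j -> j \in B -> k \notin B ->
  alive_law v ms (tperm j k @: B) <= alive_law v ms B.
Proof.
move=> v0 le_kj; elim/last_ind: ms B => [|ms m IH] B jB kB.
  rewrite /alive_law /=.
  rewrite [X in (nat_of_bool X)%:R <= _](_ : _ = false) //.
  apply/eqP => /setP/(_ j); rewrite inE -[X in X \in _](tpermR j k).
  by rewrite mem_imset ?(negPf kB) //; apply: perm_inj.
rewrite !alive_law_rcons (reindex_inj (imset_inj (@perm_inj _ (tperm j k)))) /=.
apply: ler_sum => A _.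
have [->|K_neq0] :=
  eqVneq (round_kernel v m (tperm j k @: A) (tperm j k @: B)) 0.
  by rewrite mulr0 mulr_ge0 ?round_kernel_ge0 ?alive_law_ge0.
have [/subsetP sBA _] := round_kernel_supp K_neq0.
have jA : j \in A.
  have := sBA (tperm j k j); rewrite !mem_imset; try exact: perm_inj.
  exact.
apply: ler_pM; rewrite ?round_kernel_ge0 ?alive_law_ge0 ?round_kernel_swap //.
have [kA|kA] := boolP (k \in A); last exact: IH.
by rewrite tperm_imset.
Qed.

(** * Survival probability in one round *)

(** The indicators on the right have at most one nonzero term, the slot that
    [i] occupies, where 1 is lowered by the probability that [i] loses.
    Writing it as a sum over slots makes it linear, ready for averaging over
    the draws. *)
Lemma sum_outcome_prob_survive (R : realType) n m (v : 'I_n -> R)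
    (A : {set 'I_n}) (a : {ffun 'I_m * bool -> 'I_n}) i :
    (forall l, 0 < v l) -> a \in draws m A -> i \in A ->
  \sum_(w | i \in survivors A a w) outcome_prob v a w
    = 1 + \sum_x (a x == i)%:R * (beat_prob v i (a (x.1, ~~ x.2)) - 1).
Proof.
move=> v0 /drawsP[inj_a aA] iA.
(* Surviving means choosing, independently in each match, a result in which
   [i] does not lose; [1 + e k] is the total weight of such results in match
   [k]. *)
pose e (k : 'I_m) : R :=
  \sum_(b : bool) (a (k, b) == i)%:R * (beat_prob v i (a (k, ~~ b)) - 1).
have -> : \sum_x (a x == i)%:R * (beat_prob v i (a (x.1, ~~ x.2)) - 1)
    = \sum_k e k.
  by rewrite /e pair_big; apply: eq_bigr => -[].
have factorE k : \sum_(b | a (k, ~~ b) != i)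
    beat_prob v (a (k, b)) (a (k, ~~ b)) = 1 + e k.
  have ne_a : a (k, true) != a (k, false) by apply/eqP => /inj_a.
  rewrite big_mkcond /e !big_bool /=.
  have [<-|_] := eqVneq (a (k, true)) i.
    by rewrite eq_sym (negPf ne_a) /= mul1r mul0r; ring.
  have [<-|_] := eqVneq (a (k, false)) i; first by rewrite /= mul1r mul0r; ring.
  by rewrite /= !mul0r !addr0 /beat_prob; field; rewrite !lt0r_neq0 ?addr_gt0.
have -> : \sum_(w | i \in survivors A a w) outcome_prob v a w
    = \prod_k (1 + e k).
  under eq_bigr => k _ do rewrite -factorE.
  rewrite bigA_distr_big_dep; apply: eq_bigl => w.
  rewrite in_survivors iA /=.
  by apply/forallP/familyP.
have [/existsP[[k b] /eqP def_i]|/existsPn noplay] :=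
  boolP [exists x, a x == i].
  have e0 l : l != k -> e l = 0.
    move=> ne_lk; rewrite /e big1 // => c _.
    case: eqP => [|_]; last by rewrite mul0r.
    by rewrite -def_i => /inj_a[eq_lk _]; rewrite eq_lk eqxx in ne_lk.
  rewrite (bigD1 k) //= big1 => [|l /e0 ->]; last by rewrite addr0.
  by rewrite [in RHS](bigD1 k) //= [X in _ + (_ + X)]big1 ?addr0 ?mulr1.
have e0 k : e k = 0.
  by rewrite /e big1 // => b _; rewrite (negPf (noplay _)) mul0r.
by rewrite [in RHS]big1 // big1 ?addr0 // => k _; rewrite e0 addr0.
Qed.

(** The permutations of [A] act on the draws and are doubly transitive on [A],
    so the [#|A| * (#|A| - 1)] classes of draws, according to the two players in
    slots [x] and [y], all have the same size. *)
Lemma card_draws_two n m (A : {set 'I_n}) (x y : 'I_m * bool) i j :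
    x != y -> i \in A -> j \in A -> i != j ->
  (#|A| * (#|A| - 1) * #|[set a in draws m A | (a x == i) && (a y == j)]|)%N
    = #|draws m A|.
Proof.
move=> ne_xy iA jA ne_ij.
pose N p q := #|[set a in draws m A | (a x == p) && (a y == q)]|.
have N_relabel (s : {perm 'I_n}) p q : s @: A = A -> N (s p) (s q) = N p q.
  move=> sA; rewrite /N -!sum1_card (reindex_inj (@relabel_inj n m s)) /=.
  apply: eq_bigl => a; rewrite [LHS]inE [RHS]inE -{1}sA relabel_draws !ffunE.
  by rewrite !(inj_eq perm_inj).
have N_const p q : p \in A -> q \in A :\ p -> N p q = N i j.
  move=> pA /setD1P[ne_qp qA].
  rewrite -[RHS](N_relabel (tperm i p)) ?tperm_imset // tpermL.
  set j' := tperm i p j.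
  have ne_j'p : j' != p.
    by rewrite -[p in _ != p](tpermL i p) (inj_eq perm_inj) eq_sym.
  have j'A : j' \in A by rewrite /j'; case: tpermP.
  rewrite -[RHS](N_relabel (tperm j' q)) ?tperm_imset // tpermL tpermD //.
rewrite -[RHS]sum1_card.
rewrite (partition_big (fun a : {ffun _ -> _} => a x) [in A]) /=; last first.
  by move=> a /drawsP[_ aA].
rewrite -mulnA -sum_nat_const; apply: eq_bigr => p pA.
rewrite (partition_big (fun a : {ffun _ -> _} => a y) [in A :\ p]) /=; last first.
  move=> a /andP[/drawsP[inj_a aA] /eqP <-].
  by rewrite !inE aA andbT (inj_eq inj_a) eq_sym.
have -> : (#|A| - 1)%N = #|A :\ p| by rewrite (cardsD1 p) pA addKn.
rewrite -sum_nat_const; apply: eq_bigr => q qA.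
rewrite -/(N i j) -(N_const p q) // /N -sum1_card.
by apply: eq_bigl => a; rewrite [LHS]inE andbA.
Qed.

Lemma sum_draws_two (R : realType) n m (A : {set 'I_n}) (x y : 'I_m * bool) i
    (F : 'I_n -> R) :
    x != y -> i \in A -> (2 <= #|A|)%N ->
  \sum_(a in draws m A) (a x == i)%:R * F (a y)
    = #|draws m A|%:R / (#|A|%:R * (#|A| - 1)%:R) * \sum_(j in A :\ i) F j.
Proof.
move=> ne_xy iA A2; rewrite mulr_sumr.
rewrite (bigID (fun a : {ffun 'I_m * bool -> 'I_n} => a x == i)) /=.
rewrite [X in _ + X]big1 ?addr0; last first.
  by move=> a /andP[_ /negPf->]; rewrite mul0r.
rewrite (partition_big (fun a : {ffun _ -> _} => a y) [in A :\ i]) /=; last first.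
  move=> a /andP[/drawsP[inj_a aA] /eqP <-].
  by rewrite !inE aA andbT (inj_eq inj_a) eq_sym.
apply: eq_bigr => j /setD1P[ne_ji jA].
rewrite -(card_draws_two ne_xy iA jA); last by rewrite eq_sym.
rewrite (eq_bigr (fun=> F j)); last first.
  by move=> a /andP[/andP[_ ->] /eqP ->]; rewrite mul1r.
rewrite (eq_bigl [in [set a in draws m A | (a x == i) && (a y == j)]]);
  last first.
  by move=> a; rewrite [RHS]inE andbA.
rewrite sumr_const -mulr_natl !natrM; field.
by rewrite !pnatr_eq0; lia.
Qed.

(** The player [i] sits in each of the [2m] slots with probability [1 / #|A|],
    and then the opposite slot holds a uniform player of [A :\ i]. *)
Lemma round_survive_prob (R : realType) n m (v : 'I_n -> R) (A : {set 'I_n}) i :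
    (forall l, 0 < v l) -> i \in A -> (2 <= #|A|)%N -> (2 * m <= #|A|)%N ->
  \sum_(B : {set 'I_n} | i \in B) round_kernel v m A B
    = (2 * m)%:R / #|A|%:R
        * ((#|A| - 1)%:R^-1 * \sum_(j in A :\ i) beat_prob v i j)
      + 1 - (2 * m)%:R / #|A|%:R.
Proof.
move=> v0 iA A2 mA; rewrite exchange_big /=.
transitivity (\sum_(a in draws m A) #|draws m A|%:R^-1 *
  (1 + \sum_x (a x == i)%:R * (beat_prob v i (a (x.1, ~~ x.2)) - 1))).
  apply: eq_bigr => a aD; rewrite -mulr_sumr.
  rewrite -(sum_outcome_prob_survive v0 aD iA).
  congr (_ * _).
  rewrite (partition_big (survivors A a) [pred B : {set 'I_n} | i \in B]) //=.
  apply: eq_bigr => B iB; apply: eq_bigl => w.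
  by case: eqP => [->|]; rewrite ?iB ?andbF.
have D0 : #|draws m A|%:R != 0 :> R.
  by rewrite card_draws pnatr_eq0 -lt0n ffact_gt0.
rewrite -mulr_sumr big_split /= sumr_const exchange_big /=.
rewrite (eq_bigr (fun=> #|draws m A|%:R / (#|A|%:R * (#|A| - 1)%:R)
    * \sum_(j in A :\ i) (beat_prob v i j - 1))); last first.
  move=> [k b] _ /=.
  rewrite (sum_draws_two (y := (k, ~~ b)) (fun j => beat_prob v i j - 1)) //.
  by rewrite xpair_eqE eqxx; case: b.
rewrite sumr_const card_prod card_ord card_bool sumrB sumr_const.
have -> : #|A :\ i| = (#|A| - 1)%N by rewrite [in RHS](cardsD1 i) iA addKn.
rewrite -mulr_natl [(m * 2)%N]mulnC.
set S := \sum_(j in A :\ i) _; set D := #|draws m A|%:R; rewrite -/D in D0.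
field.
by rewrite D0 !pnatr_eq0; lia.
Qed.

(** * Opponents still alive are stronger than average *)

(** Twice the difference of the two sides is the double sum of
    [(f j - f k) * (g j - g k)]. *)
Lemma chebyshev_sum_le (R : realFieldType) (T : finType) (Q : {set T})
    (f g : T -> R) :
    {in Q &, forall j k, (f j - f k) * (g j - g k) <= 0} ->
  #|Q|%:R * \sum_(j in Q) f j * g j <= (\sum_(j in Q) f j) * \sum_(j in Q) g j.
Proof.
move=> opp; set F := \sum_(j in Q) f j; set G := \sum_(j in Q) g j.
set H := \sum_(j in Q) f j * g j.
have : \sum_(j in Q) \sum_(k in Q) (f j - f k) * (g j - g k) <= 0.
  by apply: sumr_le0 => j jQ; apply: sumr_le0 => k kQ; apply: opp.
suff -> : \sum_(j in Q) \sum_(k in Q) (f j - f k) * (g j - g k)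
    = 2 * (#|Q|%:R * H - F * G) by lra.
transitivity (\sum_(j in Q) (#|Q|%:R * (f j * g j) - f j * G - F * g j + H)).
  apply: eq_bigr => j jQ.
  transitivity (\sum_(k in Q) (f j * g j - f j * g k - f k * g j + f k * g k)).
    by apply: eq_bigr => k _; ring.
  by rewrite big_split !sumrB /= sumr_const mulr_natl -mulr_sumr -mulr_suml.
rewrite big_split !sumrB /= -mulr_sumr -mulr_suml -mulr_sumr.
rewrite sumr_const -mulr_natl.
by rewrite -/F -/G -/H; ring.
Qed.

Definition alive_prob (R : realType) (n : nat) (v : 'I_n -> R) (ms : seq nat)
    (i : 'I_n) : R :=
  \sum_(A : {set 'I_n} | i \in A) alive_law v ms A.

(** The sets containing both [j] and [k] contribute equally to the two sides;
    the transposition matches the remaining ones. *)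
Lemma both_alive_le (R : realType) n (v : 'I_n -> R) ms i j k :
    (forall l, 0 < v l) -> v k <= v j -> j != i -> k != i ->
  \sum_(A : {set 'I_n} | (i \in A) && (k \in A)) alive_law v ms A
    <= \sum_(A : {set 'I_n} | (i \in A) && (j \in A)) alive_law v ms A.
Proof.
move=> v0 le_kj ne_ji ne_ki.
have mem_swap (A : {set 'I_n}) x : (x \in tperm j k @: A) = (tperm j k x \in A).
  by rewrite -[x in LHS](tpermK j k) mem_imset //; apply: perm_inj.
rewrite (bigID (fun A : {set 'I_n} => j \in A)).
rewrite [leRHS](bigID (fun A : {set 'I_n} => k \in A)) /=.
apply: lerD; first by under eq_bigl do rewrite andbAC.
rewrite (reindex_inj (imset_inj (@perm_inj _ (tperm j k)))) /=.
under eq_bigl => A do rewrite !mem_swap tpermL tpermR tpermD //.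
by apply: ler_sum => A /andP[/andP[_ jA] kA]; apply: alive_law_swap.
Qed.

(** If [r > 1], then divided by [(r - 1) * alive_prob v ms i], this bounds the conditional
    mean, given that [i] is alive, of the average of [beat_prob v i] over the
    alive opponents by [mean_beat_prob v i].
    Interchanging the sums turns the left-hand side into the sum over [j] of
    [beat_prob v i j] times the probability [g j] that [i] and [j] are both
    alive; exactly [r - 1] opponents are alive next to [i], which gives the
    total weight of [g]. *)
Lemma alive_weighted_le (R : realType) n (v : 'I_n -> R) ms i r :
    (forall l, 0 < v l) -> (r + sumn ms)%N = n -> (0 < r)%N -> (2 <= n)%N ->
  \sum_(A : {set 'I_n} | i \in A)
      alive_law v ms A * \sum_(j in A :\ i) beat_prob v i j
    <= (r - 1)%:R * mean_beat_prob v i * alive_prob v ms i.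
Proof.
move=> v0 rE r0 n2.
pose g j := \sum_(A : {set 'I_n} | (i \in A) && (j \in A)) alive_law v ms A.
have sum_pairs (f : 'I_n -> R) :
    \sum_(A : {set 'I_n} | i \in A) alive_law v ms A * \sum_(j in A :\ i) f j
      = \sum_(j in [set~ i]) f j * g j.
  under eq_bigr do rewrite mulr_sumr.
  rewrite (exchange_big_dep [in [set~ i]]) /=.
    apply: eq_bigr => j; rewrite !inE => ne_ji; rewrite mulr_sumr.
    apply: eq_big => A; first by rewrite !inE ne_ji.
    by rewrite mulrC.
  by move=> A j _; rewrite !inE => /andP[].
have sum_g : \sum_(j in [set~ i]) g j = (r - 1)%:R * alive_prob v ms i.
  have := sum_pairs (fun=> 1); under [RHS]eq_bigr do rewrite mul1r.
  move=> <-; rewrite mulr_sumr; apply: eq_bigr => A iA.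
  have [->|/alive_law_supp card_A] := eqVneq (alive_law v ms A) 0.
    by rewrite mul0r mulr0.
  rewrite sumr_const mulrC; congr (_%:R * _).
  by have := cardsD1 i A; rewrite iA; lia.
have card_others : #|[set~ i]| = (n - 1)%N.
  by rewrite cardsC1 card_ord subn1.
have cheb : (n - 1)%:R * \sum_(j in [set~ i]) beat_prob v i j * g j
    <= (\sum_(j in [set~ i]) beat_prob v i j) * \sum_(j in [set~ i]) g j.
  rewrite -card_others; apply: chebyshev_sum_le => j k.
  rewrite !inE => ne_ji ne_ki.
  wlog le_kj : j k ne_ji ne_ki / v k <= v j.
    move=> wl; have [/wl|/ltW/wl] := leP (v k) (v j); first exact.
    by move=> /(_ ne_ki ne_ji); rewrite -mulrNN !opprB.
  by rewrite mulr_le0_ge0 ?subr_le0 ?subr_ge0 ?ler_beat_prob ?both_alive_le.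
rewrite sum_pairs /mean_beat_prob.
have n1 : 0 < (n - 1)%:R :> R by rewrite ltr0n subn_gt0.
rewrite -(ler_pM2l n1); apply: le_trans cheb _; rewrite sum_g.
have -> : \sum_(j < n | j != i) beat_prob v i j
    = \sum_(j in [set~ i]) beat_prob v i j.
  by apply: eq_bigl => j; rewrite !inE.
rewrite le_eqVlt; apply/predU1P; left; field.
by rewrite lt0r_neq0.
Qed.

(** * Multiplying over the rounds *)

Lemma alive_prob_rcons_le (R : realType) n (v : 'I_n -> R) ms m i r :
    (forall l, 0 < v l) -> (r + sumn ms)%N = n -> (0 < m)%N -> (2 * m <= r)%N ->
  alive_prob v (rcons ms m) i
    <= ((2 * m)%:R / r%:R * mean_beat_prob v i + 1 - (2 * m)%:R / r%:R)
       * alive_prob v ms i.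
Proof.
move=> v0 rE m0 mr.
set c := (2 * m)%:R / r%:R.
have -> : alive_prob v (rcons ms m) i = (1 - c) * alive_prob v ms i
    + c / (r - 1)%:R * \sum_(A : {set 'I_n} | i \in A)
      alive_law v ms A * \sum_(j in A :\ i) beat_prob v i j.
  rewrite /alive_prob; under eq_bigr do rewrite alive_law_rcons.
  rewrite exchange_big /= (bigID (fun A : {set 'I_n} => i \in A)) /=.
  rewrite [X in _ + X]big1 ?addr0 => [|A iA]; last first.
    rewrite big1 // => B iB.
    have [->|/round_kernel_supp[/subsetP sBA _]] :=
      eqVneq (round_kernel v m A B) 0.
      by rewrite mulr0.
    by rewrite (sBA _ iB) in iA.
  rewrite [(1 - c) * _]mulr_sumr [c / _ * _]mulr_sumr -big_split.
  apply: eq_bigr => A iA /=; rewrite -mulr_sumr.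
  have [->|/alive_law_supp card_A] := eqVneq (alive_law v ms A) 0.
    by rewrite !(mul0r, mulr0) addr0.
  have card_Ar : #|A| = r by lia.
  rewrite round_survive_prob ?card_Ar //; last by lia.
  rewrite -/c; ring.
have c0 : 0 <= c / (r - 1)%:R by rewrite !divr_ge0.
have r1 : (r - 1)%:R != 0 :> R by rewrite pnatr_eq0; lia.
apply: le_trans
  (lerD (lexx _) (ler_wpM2l c0 (alive_weighted_le i v0 rE _ _))) _; try lia.
by rewrite le_eqVlt; apply/predU1P; left; field.
Qed.

Theorem theorem2 (R : realType) (n : nat) (v : 'I_n -> R) (ms : seq nat)
    (hn : (2 <= n)%N) (hv : forall j : 'I_n, 0 < v j) (hms : is_format n ms)
    (i : 'I_n) :
  win_prob v ms i <=
    \prod_(s < size ms)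
      ((2 * nth 0%N ms s)%:R / (players_left n ms s)%:R * mean_beat_prob v i
       + 1 - (2 * nth 0%N ms s)%:R / (players_left n ms s)%:R).
Proof.
case: hms => _ ms_gt0 _ ms_le.
have mean_ge0 : 0 <= mean_beat_prob v i.
  by rewrite mulr_ge0 ?invr_ge0 // sumr_ge0 // => j _; apply: beat_prob_ge0.
have alive_le t : (t <= size ms)%N -> alive_prob v (take t ms) i <=
    \prod_(s < t)
      ((2 * nth 0%N ms s)%:R / (players_left n ms s)%:R * mean_beat_prob v i
       + 1 - (2 * nth 0%N ms s)%:R / (players_left n ms s)%:R).
  elim: t => [|t IH] t_le.
    rewrite take0 big_ord0 /alive_prob /alive_law /=.
    rewrite (bigD1 [set: 'I_n]) ?inE //=.
    by rewrite eqxx big1 ?addr0 // => A /andP[_ /negPf->].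
  have [m_gt0 m_le] := (ms_gt0 t t_le, ms_le t t_le).
  rewrite big_ord_recr /= mulrC (take_nth 0%N) //.
  have rE : (players_left n ms t + sumn (take t ms))%N = n.
    by move: m_le; rewrite /players_left; lia.
  apply: le_trans (alive_prob_rcons_le i hv rE m_gt0 m_le) _.
  apply: ler_wpM2l; last by apply: IH; apply: ltnW.
  rewrite -addrA; apply: addr_ge0; first by rewrite mulr_ge0 ?divr_ge0.
  rewrite subr_ge0.
  by rewrite ler_pdivrMr ?mul1r ?ler_nat ?ltr0n //; lia.
(* Winning is one of the ways of being alive after the last round. *)
have := alive_le _ (leqnn _); rewrite take_size; apply: le_trans.
rewrite /win_prob /alive_prob (bigD1 [set i]) ?inE //= lerDl.
by apply: sumr_ge0 => A _; apply: alive_law_ge0.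
Qed.
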